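(* If $D$ is a self-paired maximal Arrow's single-peaked domain with inherited permutation $\theta$, then $\theta$ must have order $2$.
   Context: A linear order on a finite set $A$ of size $m$ is identified with a directed Hamilton path through $A$, i.e. a sequence $(a_1,\dots,a_m)$ listing every element of $A$ exactly once (most preferred first). A set $D$ of linear orders on $A$ is a Condorcet domain if there are no three orders in $D$ and distinct $a_1,a_2,a_3\in A$ such that the three orders rank these elements as $a_1\succ a_2\succ a_3$, $a_2\succ a_3\succ a_1$, $a_3\succ a_1\succ a_2$ respectively. It is maximal if it is not properly contained in another Condorcet domain on $A$. An Arrow's single-peaked domain is a Condorcet domain $D$ such that every triple (3-element subset) $T\subseteq A$ has a ''never-bottom'' element, i.e. an element of $T$ which no order of $D$ ranks last among the elements of $T$. A maximal Arrow's single-peaked domain is an Arrow's single-peaked domain which is maximal as a Condorcet domain. A terminal vertex of $D$ is an element which is last in some order of $D$; a maximal Arrow's single-peaked domain has exactly two terminal vertices $s,f$. A path in $D$ is extremal if it starts at one terminal vertex and ends at the other; $D$ has exactly two extremal paths, $P=(s,a_1,\dots,a_{m-2},f)$ and $Q$, which runs from $f$ to $s$. Permutations act on paths entrywise. The inherited permutation of $D$ is the permutation $\theta$ of $A$ with $\theta(P)=Q$; it swaps $s$ and $f$. $D$ is self-paired if $\{\theta(W):W\in D\}=D$. *)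

(* Defs.v *)
From HB Require Import structures.
From mathcomp Require Import all_boot all_fingroup.

Set Implicit Arguments.
Unset Strict Implicit.
Unset Printing Implicit Defensive.

(* A repetition-free tuple of length #|A| lists every element of A exactly
   once; the head is the most preferred element. *)
Record linorder (A : finType) :=
  LinOrder { ranking :> #|A|.-tuple A; ranking_uniq : uniq ranking }.

HB.instance Definition _ (A : finType) := [isSub for @ranking A].
HB.instance Definition _ (A : finType) := [Finite of linorder A by <:].

Definition prefers (A : finType) (W : linorder A) (x y : A) : bool :=
  index x W < index y W.

Definition condorcet (A : finType) (D : {set linorder A}) : Prop :=
  ~ exists (W1 W2 W3 : linorder A) (a1 a2 a3 : A),
      [/\ W1 \in D, W2 \in D & W3 \in D] /\
      uniq [:: a1; a2; a3] /\
      [/\ prefers W1 a1 a2 && prefers W1 a2 a3,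
          prefers W2 a2 a3 && prefers W2 a3 a1 &
          prefers W3 a3 a1 && prefers W3 a1 a2].

Definition maximal_condorcet (A : finType) (D : {set linorder A}) : Prop :=
  condorcet D /\
  forall E : {set linorder A}, condorcet E -> ~~ (D \proper E).

Definition bottom_in (A : finType) (W : linorder A) (T : {set A}) (x : A) :
    Prop :=
  x \in T /\ forall y, y \in T -> y != x -> prefers W y x.

Definition never_bottom (A : finType) (D : {set linorder A}) (T : {set A})
    (x : A) : Prop :=
  x \in T /\ forall W, W \in D -> ~ bottom_in W T x.

Definition arrow_single_peaked (A : finType) (D : {set linorder A}) : Prop :=
  condorcet D /\
  forall T : {set A}, #|T| = 3 -> exists x, never_bottom D T x.

Definition maximal_arrow_single_peaked (A : finType)
    (D : {set linorder A}) : Prop :=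
  arrow_single_peaked D /\ maximal_condorcet D.

(* The default value x of head and last is never used below: the existence of
   x : A makes every linear order on A nonempty. *)
Definition starts_at (A : finType) (W : linorder A) (x : A) : Prop :=
  head x W = x.

Definition ends_at (A : finType) (W : linorder A) (x : A) : Prop :=
  last x W = x.

Definition terminal (A : finType) (D : {set linorder A}) (x : A) : Prop :=
  exists2 W, W \in D & ends_at W x.

Definition extremal (A : finType) (D : {set linorder A}) (s f : A)
    (W : linorder A) : Prop :=
  [/\ terminal D s, terminal D f & s != f] /\
  [/\ W \in D, starts_at W s & ends_at W f].

Lemma permute_uniq (A : finType) (theta : {perm A}) (W : linorder A) :
  uniq (map_tuple theta W).
Proof. by rewrite map_inj_uniq ?ranking_uniq //; apply: perm_inj. Qed.

Definition permute (A : finType) (theta : {perm A}) (W : linorder A) :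
    linorder A :=
  LinOrder (permute_uniq theta W).

(* The names s and f of the two terminal vertices may be exchanged, which
   exchanges P and Q and replaces theta by its inverse; both choices are
   allowed here. That the two terminal vertices and the two extremal paths
   are unique is a property of maximal Arrow's single-peaked domains and is
   not required by this definition. *)
Definition inherited_perm (A : finType) (D : {set linorder A})
    (theta : {perm A}) : Prop :=
  exists (s f : A) (P Q : linorder A),
    [/\ extremal D s f P, extremal D f s Q & permute theta P = Q].

Definition self_paired (A : finType) (D : {set linorder A})
    (theta : {perm A}) : Prop :=
  [set permute theta W | W in D] = D.

(* Main.v *)
Require Import Defs.
From mathcomp Require Import all_boot all_fingroup.
From mathcomp Require Import cyclic.

(** Let [P] in [D] run from [s] to [f], and [Q = theta P] in [D] from [f] to [s].
    Only one order of [D] starts at [s]. Two distinct ones would rank some pair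
    [x], [y] oppositely, so among [s, x, y] one of them ranks [y] last and the
    other ranks [x] last, while [Q] ranks [s] last: the triple would have no
    never-bottom element ([eq_starts_at_terminal]).

    Comparing the ends of [P] and [Q] shows that [theta] exchanges [s] and [f].
    By self-pairing [theta Q] is again in [D], and it starts at [theta f = s],
    so it is [P]. Thus [theta ^+ 2] fixes the sequence [P] entrywise, hence
    fixes every element of [A]; and [theta] is not the identity, as it moves
    [s]. *)

Lemma mem_linorder {A : finType} (W : linorder A) (x : A) : x \in (W : seq A).
Proof.
have cardW : #|(W : seq A)| = #|A|.
  by rewrite (card_uniqP (ranking_uniq W)) size_tuple.
by rewrite (subset_cardP cardW (subset_predT _)).
Qed.

Lemma sorted_prefers {A : finType} (W : linorder A) : sorted (prefers W) W.
Proof.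
have [x0 _|] := pickP (mem (W : seq A)).
  apply: pairwise_sorted; apply/(pairwiseP x0) => i j ltiW ltjW ltij.
  by rewrite /prefers !index_uniq // ranking_uniq.
by case: (W : seq A) => // x s /(_ x); rewrite inE /= inE eqxx.
Qed.

Lemma prefers_trans {A : finType} (W : linorder A) : transitive (prefers W).
Proof. by move=> y x z; apply: ltn_trans. Qed.

Lemma prefers_total {A : finType} (W : linorder A) {x y : A} :
  x != y -> prefers W x y || prefers W y x.
Proof.
rewrite /prefers -neq_ltn; apply: contra => /eqP eq_index.
by rewrite (index_inj x (mem_linorder W x) (mem_linorder W y) eq_index).
Qed.

(** If no pair were reversed, [W1] would be sorted for the strict order of [W2];
    so is [W2], and [A] has only one sorted listing. *)
Lemma neq_linorder_disagree {A : finType} {W1 W2 : linorder A} :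
  W1 != W2 -> exists x y, prefers W1 x y && prefers W2 y x.
Proof.
move=> neqW; have [/existsP[x /existsP[y Hxy]]|] :=
  boolP [exists x, exists y, prefers W1 x y && prefers W2 y x].
  by exists x, y.
move=> /existsPn agree; case/eqP: neqW; apply/val_inj/val_inj => /=.
apply: (@irr_sorted_eq _ (prefers W2)).
- exact: prefers_trans.
- by move=> x; apply: ltnn.
- apply: sub_sorted (sorted_prefers W1) => x y lt1xy.
  have neqxy: x != y.
    by apply: contraTneq lt1xy => ->; rewrite /prefers ltnn.
  have /existsPn/(_ y) := agree x; rewrite lt1xy /= => /negPf nyx.
  by have := prefers_total W2 neqxy; rewrite nyx orbF.
- exact: sorted_prefers.
- by move=> x; rewrite !mem_linorder.
Qed.

Lemma starts_at_index {A : finType} {W : linorder A} {s : A} :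
  starts_at W s -> index s W = 0.
Proof.
rewrite /starts_at; have := mem_linorder W s.
by case: (W : seq A) => //= x r _ ->; rewrite eqxx.
Qed.

Lemma starts_at_prefers {A : finType} {W : linorder A} {s x : A} :
  starts_at W s -> x != s -> prefers W s x.
Proof.
move=> Ws neqxs; have := prefers_total W neqxs.
by rewrite /prefers (starts_at_index Ws).
Qed.

Lemma starts_at_preferredN {A : finType} {W : linorder A} {s x y : A} :
  starts_at W s -> prefers W x y -> y != s.
Proof.
by move=> Ws; apply: contraTneq => ->; rewrite /prefers (starts_at_index Ws).
Qed.

Lemma ends_at_prefers {A : finType} {W : linorder A} {s x : A} :
  ends_at W s -> x != s -> prefers W x s.
Proof.
move=> Ws neqxs; have xW := mem_linorder W x.
have index_s : index s W = (size W).-1.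
  have := ranking_uniq W; move: Ws (mem_linorder W s); rewrite /ends_at.
  by case: (W : seq A) => // y r; rewrite [last _ _]/= => <- _ /index_last.
have : index x W <= index s W.
  by rewrite index_s; move: xW; rewrite -index_mem; case: size.
by have := prefers_total W neqxs; rewrite /prefers; case: ltngtP.
Qed.

(** A triple is protected by a never-bottom element, so its three elements
    cannot each be ranked last by some order of the domain. *)
Lemma arrow_single_peaked_bottomN {A : finType} {D : {set linorder A}}
    {W1 W2 W3 : linorder A} (x y z : A) :
  arrow_single_peaked D -> W1 \in D -> W2 \in D -> W3 \in D ->
  uniq [:: x; y; z] ->
  prefers W1 y x -> prefers W1 z x ->
  prefers W2 x y -> prefers W2 z y ->
  prefers W3 x z -> prefers W3 y z -> False.
Proof.
move=> [_ peaked] D1 D2 D3 xyz_uniq yx1 zx1 xy2 zy2 xz3 yz3.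
have card3 : #|[set x; y; z]| = 3.
  rewrite -[RHS]/(size [:: x; y; z]) -(card_uniqP xyz_uniq).
  by apply: eq_card => t; rewrite !inE -orbA.
have [t [tT nbot]] := peaked _ card3.
have := tT; rewrite !inE => /orP[/orP[]|] /eqP def_t; subst t.
- by apply: (nbot _ D1); split=> // u; rewrite !inE => /orP[/orP[]|] /eqP->;
    rewrite ?eqxx.
- by apply: (nbot _ D2); split=> // u; rewrite !inE => /orP[/orP[]|] /eqP->;
    rewrite ?eqxx.
- by apply: (nbot _ D3); split=> // u; rewrite !inE => /orP[/orP[]|] /eqP->;
    rewrite ?eqxx.
Qed.

(** This contains the uniqueness of the extremal path from [s] to the other
    terminal vertex. It holds because two orders starting at [s] that disagree
    on [x], [y] put [y] and [x] respectively at the bottom of [{s, x, y}], and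
    terminality of [s] provides an order with [s] at the bottom. *)
Lemma eq_starts_at_terminal {A : finType} {D : {set linorder A}} {s : A}
    {W1 W2 : linorder A} :
  arrow_single_peaked D -> terminal D s ->
  W1 \in D -> W2 \in D -> starts_at W1 s -> starts_at W2 s -> W1 = W2.
Proof.
move=> peaked [W3 D3 W3s] D1 D2 W1s W2s; apply/eqP.
case: eqVneq => // /neq_linorder_disagree[x [y /andP[xy1 yx2]]].
have neqys := starts_at_preferredN W1s xy1.
have neqxs := starts_at_preferredN W2s yx2.
have neqxy : x != y by apply: contraTneq xy1 => ->; rewrite /prefers ltnn.
case: (arrow_single_peaked_bottomN s x y peaked D3 D2 D1)
  => //; try by [apply: starts_at_prefers | apply: ends_at_prefers].
by rewrite /= !inE negb_or ![s == _]eq_sym neqxs neqys neqxy.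
Qed.

Lemma starts_at_permute {A : finType} (theta : {perm A}) {W : linorder A}
    {x : A} :
  starts_at W x -> starts_at (permute theta W) (theta x).
Proof. by rewrite /starts_at /=; case: (W : seq A) => //= y r ->. Qed.

Lemma starts_at_inj {A : finType} {W : linorder A} {x y : A} :
  starts_at W x -> starts_at W y -> x = y.
Proof.
rewrite /starts_at; have := mem_linorder W x.
by case: (W : seq A) => //= z r _ ->.
Qed.

Lemma ends_at_permute {A : finType} (theta : {perm A}) {W : linorder A}
    {x : A} :
  ends_at W x -> ends_at (permute theta W) (theta x).
Proof. by rewrite /ends_at /= last_map => ->. Qed.

Lemma ends_at_inj {A : finType} {W : linorder A} {x y : A} :
  ends_at W x -> ends_at W y -> x = y.
Proof.
rewrite /ends_at; have := mem_linorder W x.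
by case: (W : seq A) => //= z r _ ->.
Qed.

Lemma permute_fix {A : finType} {theta : {perm A}} {W : linorder A} :
  permute theta W = W -> theta = 1%g.
Proof.
move=> /(congr1 (fun V : linorder A => V : seq A)) /= fixW.
apply/permP => x; rewrite perm1.
have /eq_in_map/(_ x (mem_linorder W x)) // : map theta W = map id W.
by rewrite map_id.
Qed.

Lemma permuteM {A : finType} (theta eta : {perm A}) (W : linorder A) :
  permute (theta * eta)%g W = permute eta (permute theta W).
Proof.
apply/val_inj/val_inj; rewrite /= -map_comp.
by apply: eq_map => x; rewrite permM.
Qed.

Theorem lemma5p5 (A : finType) (D : {set linorder A}) (theta : {perm A})
    (hD : maximal_arrow_single_peaked D)
    (htheta : inherited_perm D theta)
    (hself : self_paired D theta) :
  #[theta]%g = 2.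
Proof.
have [peaked _] := hD.
have [s [f [P [Q [[[term_s _ neqsf] [PD Ps Pf]] [_ [QD Qf Qs]] defQ]]]]] :=
  htheta.
have theta_s : theta s = f.
  by apply: (starts_at_inj _ Qf); rewrite -defQ; apply: starts_at_permute.
have theta_f : theta f = s.
  by apply: (ends_at_inj _ Qs); rewrite -defQ; apply: ends_at_permute.
have thetaQ : permute theta Q = P.
  apply: eq_starts_at_terminal peaked term_s _ PD _ Ps.
    by rewrite -hself imset_f.
  by rewrite -theta_f; apply: starts_at_permute.
apply: nt_prime_order => //.
  by apply: (permute_fix (W := P)); rewrite expgS expg1 permuteM defQ.
by apply: contraNneq neqsf => theta1; rewrite -theta_s theta1 perm1.
Qed.
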